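(* Let $G\le S_n$ be a group containing $C_n$ as a subgroup, let $\pi_1,\dots,\pi_k\in S_n$ and $P=\bigcup_{i=1}^k\pi_iG$. Then, given $\pi_1,\dots,\pi_k$ and representatives of the left cosets of $C_n$ in $G$, for any permutation $\pi\in S_n$ the Hamming distance $hd(\pi,P)=\min_{\sigma\in P}hd(\pi,\sigma)$ can be computed in $O(k|G|)$ time.
   Context: $S_n$ is the symmetric group on $Z_n=\{0,\dots,n-1\}$ with composition $(\pi\sigma)(i)=\sigma(\pi(i))$, permutations represented as arrays; $\pi G=\{\pi g\mid g\in G\}$. $C_n=\{g_j\mid j\in Z_n\}$ where $g_j(i)=(i+j)\bmod n$. $hd(\pi,\sigma)$ is the number of $x$ with $\pi(x)\ne\sigma(x)$. *)

(* Defs.v *)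
From mathcomp Require Import all_boot all_fingroup.

Set Implicit Arguments.
Unset Strict Implicit.
Unset Printing Implicit Defensive.

(* Permutations of Z_n are elements of 'S_n, whose product satisfies
   (s * t) i = t (s i): permutations are composed from left to right. *)

Section Permutations.

Variable n : nat.
Implicit Types (i j : 'I_n) (s t : 'S_n).

Lemma rotation_subproof j i : (i + j) %% n < n.
Proof. by rewrite ltn_mod (leq_ltn_trans _ (ltn_ord i)). Qed.

Definition rotation_fun j i : 'I_n := Ordinal (rotation_subproof j i).

Lemma rotation_fun_inj j : injective (rotation_fun j).
Proof.
move=> i1 i2 /(congr1 val) /= /eqP; rewrite eqn_modDr !modn_small //.
by move/eqP/val_inj.
Qed.

Definition rotation j : 'S_n := perm (@rotation_fun_inj j).

Definition rotations : {set 'S_n} := [set rotation j | j : 'I_n].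

Definition hd s t : nat := #|[set x | s x != t x]|.

(* The default value n only matters when P is empty, since hd s t <= n. *)
Definition hd_set s (P : {set 'S_n}) : nat := \big[minn/n]_(t in P) hd s t.

(* reps lists exactly one representative of each left coset of H in G. *)
Definition lcoset_reps (H G : {set 'S_n}) (reps : seq 'S_n) : bool :=
  uniq reps && is_transversal [set r in reps] (lcosets H G) G.

Definition array s : seq nat := [seq val (s i) | i <- enum 'I_n].

(* Layout of the input: three size parameters, then the permutations as
   consecutive arrays of length n. *)
Definition encode_input (pis reps : seq 'S_n) (pi : 'S_n) : seq nat :=
  [:: n; size pis; size reps] ++ array pi
    ++ flatten [seq array s | s <- pis] ++ flatten [seq array r | r <- reps].

End Permutations.

(* Running time is measured on a unit-cost word RAM with structured control
   flow. A machine of word size w has registers and a random-access memory,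
   both holding words (naturals below 2 ^ w, an invariant of the execution once
   the input consists of words). Registers are named directly by
   the program, memory is only reached through an address held in a register.
   Every elementary instruction and every evaluation of a test costs 1. There
   is no multiplication, division or bitwise instruction. *)

Inductive program : Type :=
| Skip
| Const (x c : nat)
| Add (x y z : nat)
| Sub (x y z : nat)
| Read (x y : nat)              (* register x := memory cell at address y *)
| Write (x y : nat)             (* memory cell at address x := register y *)
| Seq (p q : program)
| IfLt (x y : nat) (p q : program)
| WhileLt (x y : nat) (p : program).

Record state := State { reg : nat -> nat; mem : nat -> nat }.

Definition set_reg (s : state) (x v : nat) : state :=
  State [eta reg s with x |-> v] (mem s).

Definition set_mem (s : state) (a v : nat) : state :=
  State (reg s) [eta mem s with a |-> v].

(* exec w p s t s' : on word size w, p started in s halts in s' after exactly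
   t steps. Addition wraps around; subtraction is truncated at 0. *)
Inductive exec (w : nat) : program -> state -> nat -> state -> Prop :=
| ExecSkip s : exec w Skip s 1 s
| ExecConst x c s :
    exec w (Const x c) s 1 (set_reg s x (c %% 2 ^ w))
| ExecAdd x y z s :
    exec w (Add x y z) s 1 (set_reg s x ((reg s y + reg s z) %% 2 ^ w))
| ExecSub x y z s :
    exec w (Sub x y z) s 1 (set_reg s x (reg s y - reg s z))
| ExecRead x y s :
    exec w (Read x y) s 1 (set_reg s x (mem s (reg s y)))
| ExecWrite x y s :
    exec w (Write x y) s 1 (set_mem s (reg s x) (reg s y))
| ExecSeq p q s1 s2 s3 t1 t2 :
    exec w p s1 t1 s2 -> exec w q s2 t2 s3 ->
    exec w (Seq p q) s1 (t1 + t2) s3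
| ExecIfTrue x y p q s s' t :
    reg s x < reg s y -> exec w p s t s' ->
    exec w (IfLt x y p q) s t.+1 s'
| ExecIfFalse x y p q s s' t :
    reg s y <= reg s x -> exec w q s t s' ->
    exec w (IfLt x y p q) s t.+1 s'
| ExecWhileTrue x y p s1 s2 s3 t1 t2 :
    reg s1 x < reg s1 y -> exec w p s1 t1 s2 ->
    exec w (WhileLt x y p) s2 t2 s3 ->
    exec w (WhileLt x y p) s1 (t1 + t2).+1 s3
| ExecWhileFalse x y p s :
    reg s y <= reg s x -> exec w (WhileLt x y p) s 1 s.

Definition init_state (input : seq nat) : state :=
  State (fun=> 0) (nth 0 input).

Definition computes_within (w : nat) (p : program) (input : seq nat)
    (output T : nat) : Prop :=
  exists (t : nat) (s : state),
    [/\ exec w p (init_state input) t s, reg s 0 = output & t <= T].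

(* Main.v *)
(** With [s * t] meaning "first s, then t", the coset of [r] under the rotations
    consists of the maps [x |-> r x + j], so the permutations of P are
    [x |-> r (pi_i x) + j mod n]. For fixed [i] and [r], each point [x] agrees
    with [pi] for exactly one [j], namely [pi x - r (pi_i x) mod n]; one pass
    over [x] therefore tallies the agreements for all [n] values of [j] at once,
    and the distance is [n] minus the largest tally over all [i], [r], [j].
    With [#|G| = n * m] for [m] representatives this costs
    [O(k * m * n) = O(k * #|G|)]. *)
Require Import Defs.
From mathcomp Require Import all_boot all_fingroup.
From mathcomp Require Import zify.
(* Restores [Sub] and [mem], which MathComp shadows. *)
Import Defs.

Set Implicit Arguments.
Unset Strict Implicit.
Unset Printing Implicit Defensive.

(** * Time-bounded total correctness, with a rule for each instruction *)

Definition runs w p T s (Q : state -> Prop) : Prop :=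
  exists t s', [/\ exec w p s t s', t <= T & Q s'].

(** The closing [Skip] costs one step, so a block takes one step more than its instructions.
    Simplification is blocked so that the rules below keep matching. *)
Definition block : seq program -> program := foldr Seq Skip.
Arguments block _ : simpl never.

Section Runs.

Variable w : nat.
Implicit Types (l : seq program) (p : program) (s : state) (Q : state -> Prop).

Lemma runs_mono p T T' s Q Q' :
  runs w p T s Q -> T <= T' -> (forall s', Q s' -> Q' s') -> runs w p T' s Q'.
Proof.
move=> [t [s' [ps' tT Qs']]] TT' QQ'; exists t, s'.
by split; [| apply: leq_trans TT' | apply: QQ'].
Qed.

Lemma runs_nil T s Q : Q s -> runs w (block [::]) T.+1 s Q.
Proof. by move=> Qs; exists 1, s; split=> //; apply: ExecSkip. Qed.

Lemma runs_cons p l T1 T2 s Q :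
  runs w p T1 s (fun s' => runs w (block l) T2 s' Q) ->
  runs w (block (p :: l)) (T1 + T2) s Q.
Proof.
move=> [t1 [s1 [ps1 tT1 [t2 [s2 [ls2 tT2 Qs2]]]]]].
exists (t1 + t2), s2; split=> //; last exact: leq_add.
exact: ExecSeq ls2.
Qed.

Lemma runs_cons1 p l T s s' Q :
  exec w p s 1 s' -> runs w (block l) T s' Q ->
  runs w (block (p :: l)) T.+1 s Q.
Proof. by move=> ps' ls'; apply: (@runs_cons p l 1 T); exists 1, s'. Qed.

Lemma runs_const x c l T s Q :
  c < 2 ^ w -> runs w (block l) T (set_reg s x c) Q ->
  runs w (block (Const x c :: l)) T.+1 s Q.
Proof.
by move=> cw; apply: runs_cons1; rewrite -{2}(modn_small cw); apply: ExecConst.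
Qed.

Lemma runs_add x y z l T s Q :
  reg s y + reg s z < 2 ^ w ->
  runs w (block l) T (set_reg s x (reg s y + reg s z)) Q ->
  runs w (block (Add x y z :: l)) T.+1 s Q.
Proof.
by move=> yzw; apply: runs_cons1; rewrite -(modn_small yzw); apply: ExecAdd.
Qed.

Lemma runs_sub x y z l T s Q :
  runs w (block l) T (set_reg s x (reg s y - reg s z)) Q ->
  runs w (block (Sub x y z :: l)) T.+1 s Q.
Proof. by apply: runs_cons1; apply: ExecSub. Qed.

Lemma runs_read x y l T s Q :
  runs w (block l) T (set_reg s x (mem s (reg s y))) Q ->
  runs w (block (Read x y :: l)) T.+1 s Q.
Proof. by apply: runs_cons1; apply: ExecRead. Qed.

Lemma runs_write x y l T s Q :
  runs w (block l) T (set_mem s (reg s x) (reg s y)) Q ->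
  runs w (block (Write x y :: l)) T.+1 s Q.
Proof. by apply: runs_cons1; apply: ExecWrite. Qed.

Lemma runs_select a b x y z l T s Q :
  reg s y + reg s z < 2 ^ w ->
  runs w (block l) T
    (set_reg s x (if reg s a < reg s b then reg s y + reg s z else 0)) Q ->
  runs w (block (IfLt a b (Add x y z) (Const x 0) :: l)) T.+2 s Q.
Proof.
move=> yzw ls; apply: (@runs_cons _ _ 2 T).
eexists 2, _; split; last exact: ls; last by [].
case: ltnP => ab.
  by apply: ExecIfTrue => //; rewrite -(modn_small yzw); apply: ExecAdd.
by apply: ExecIfFalse => //; have := ExecConst w x 0 s; rewrite mod0n.
Qed.

(** The invariant is indexed by the number of completed iterations, and the test must hold exactly
    while this is below [N]. Each iteration pays for its test, and the failing test adds one
    step. *)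
Lemma runs_while x y p T N (I : nat -> state -> Prop) s :
    (forall i s, i <= N -> I i s -> (reg s x < reg s y) = (i < N)) ->
    (forall i s, i < N -> I i s -> runs w p T s (I i.+1)) ->
  I 0 s -> runs w (WhileLt x y p) (N * T.+1).+1 s (I N).
Proof.
move=> test body; rewrite -[in I 0 s](subnn N).
(* Induction on the number [d] of iterations still to run. *)
suff H d s1 : d <= N -> I (N - d) s1 ->
  runs w (WhileLt x y p) (d * T.+1).+1 s1 (I N) by apply: H.
elim: d s1 => {s} [|d IH] s dN Is.
  rewrite subn0 in Is; exists 1, s; split=> //; apply: ExecWhileFalse.
  by rewrite leqNgt (test _ _ _ Is) ?ltnn.
have lt_dN : N - d.+1 < N by lia.
have [t1 [s1 [ps1 tT]]] := body _ _ lt_dN Is.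
rewrite subnSK // => /(IH _ (ltnW dN)) [t2 [s2 [ps2 tT2 Is2]]].
exists (t1 + t2).+1, s2; split=> //; last lia.
by apply: ExecWhileTrue ps1 ps2; rewrite (test _ _ _ Is) // ltnW.
Qed.

End Runs.

(** * The program and its registers *)

Local Notation rOut := 0 (only parsing).
Local Notation rN := 1 (only parsing).
Local Notation rK := 2 (only parsing).
Local Notation rM := 3 (only parsing).
Local Notation rOne := 4 (only parsing).
Local Notation rZero := 5 (only parsing).
Local Notation rThree := 6 (only parsing).
(** [rReps] and [rTally] hold the addresses where the representatives and the tallies start. They
    also bound the loops in which [rP] and [rQ] walk through the arrays. *)
Local Notation rReps := 7 (only parsing).
Local Notation rTally := 8 (only parsing).
Local Notation rP := 9 (only parsing).
Local Notation rQ := 10 (only parsing).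
Local Notation rX := 11 (only parsing).
Local Notation rA := 12 (only parsing).
Local Notation rV := 13 (only parsing).
Local Notation rU := 14 (only parsing).
Local Notation rBest := 15 (only parsing).

Definition clear_step : seq program :=
  [:: Add rA rTally rX; Write rA rZero; Add rX rX rOne].

(* Subtraction being truncated, [best + (v - best)] is the maximum of [best]
   and [v]. *)
Definition count_step : seq program :=
  [:: Add rA rP rX; Read rV rA; Add rA rQ rV; Read rV rA;
      Add rA rThree rX; Read rU rA;
      IfLt rU rV (Add rA rN rZero) (Const rA 0); Add rU rU rA; Sub rU rU rV;
      Add rA rTally rU; Read rV rA; Add rV rV rOne; Write rA rV;
      Sub rV rV rBest; Add rBest rBest rV; Add rX rX rOne].

Definition rep_step : seq program :=
  [:: Const rX 0; WhileLt rX rN (block clear_step);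
      Const rX 0; WhileLt rX rN (block count_step); Add rQ rQ rN].

Definition perm_step : seq program :=
  [:: Add rQ rReps rZero; WhileLt rQ rTally (block rep_step); Add rP rP rN].

(** For lack of a multiplication, the two addresses are reached by adding [n] repeatedly, [k] and
    then [m] times. [rZero], [rBest] and the first use of [rX] rely on registers being 0
    initially. *)
Definition hd_program : program := block
  [:: Const rOne 1; Const rA 2; Const rThree 3;
      Read rN rZero; Read rK rOne; Read rM rA;
      Add rReps rThree rN; Add rP rReps rZero;
      WhileLt rX rK (block [:: Add rReps rReps rN; Add rX rX rOne]);
      Const rX 0; Add rTally rReps rZero;
      WhileLt rX rM (block [:: Add rTally rTally rN; Add rX rX rOne]);
      WhileLt rP rReps (block perm_step); Sub rOut rN rBest].

(** * Invariants and running time of the program *)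

Section Correctness.

Variables (w n k m : nat) (A : nat -> nat).

Definition reps_addr := 3 + n + k * n.
(** The first cell past the input, hence also the input length. *)
Definition tally_addr := reps_addr + m * n.

Definition perm_entry i x := A (3 + n + i * n + x).
Definition rep_entry r x := A (reps_addr + r * n + x).

(* The residue of [u - v] modulo [n], for [u, v < n]. *)
Definition shift i r x :=
  let u := A (3 + x) in let v := rep_entry r (perm_entry i x) in
  u + (if u < v then n else 0) - v.

Definition tally i r X j := \sum_(x < X) (shift i r x == j : nat).

(** The maximum as the program meets it: after each point, only the tally just incremented is
    compared. *)
Definition peak i r X := \max_(x < X) tally i r x.+1 (shift i r x).

(** The value of [rBest] once the first [i] permutations are done with all representatives, and the
    next one with the first [r]. *)
Definition best i r := maxn (\max_(i' < i) \max_(r' < m) peak i' r' n)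
                            (\max_(r' < r) peak i r' n).

(** Every sum formed by the program stays below twice the input length, so the factor 2 rules out
    wraparound. *)
Hypotheses (n_gt0 : 0 < n) (wP : 2 * tally_addr <= 2 ^ w).
Hypotheses (A0 : A 0 = n) (A1 : A 1 = k) (A2 : A 2 = m).
Hypothesis pi_lt : forall x, x < n -> A (3 + x) < n.
Hypothesis perm_lt : forall i x, i < k -> x < n -> perm_entry i x < n.
Hypothesis rep_lt : forall r x, r < m -> x < n -> rep_entry r x < n.

(** What the main loops preserve: the first nine registers and the input cells. They write to memory
    only from [tally_addr] on. *)
Definition ready s : Prop :=
  (forall x, x < 9 ->
     reg s x = nth 0 [:: 0; n; k; m; 1; 0; 3; reps_addr; tally_addr] x) /\
  (forall a, a < tally_addr -> mem s a = A a).

Lemma ready_set_reg s x v : 9 <= x -> ready s -> ready (set_reg s x v).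
Proof.
move=> x9 [regs mems]; split=> // y y9 /=.
by rewrite ifN; [apply: regs | lia].
Qed.

Lemma ready_set_mem s a v : tally_addr <= a -> ready s -> ready (set_mem s a v).
Proof.
move=> ta [regs mems]; split=> // b bt /=.
by rewrite ifN; [apply: mems | lia].
Qed.

Lemma perm_block_le i : i < k -> i * n + n <= k * n.
Proof. by move=> ik; rewrite -mulSnr leq_mul2r ik orbT. Qed.

Lemma rep_block_le r : r < m -> r * n + n <= m * n.
Proof. by move=> rm; rewrite -mulSnr leq_mul2r rm orbT. Qed.

Lemma shift_lt i r x : i < k -> r < m -> x < n -> shift i r x < n.
Proof.
move=> ik rm xn; rewrite /shift /=.
have := rep_lt rm (perm_lt ik xn); have := pi_lt xn.
by case: ifP; lia.
Qed.

Lemma tallyS i r X j :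
  tally i r X.+1 j = tally i r X j + (shift i r X == j).
Proof. by rewrite /tally big_ord_recr. Qed.

Lemma tally_le i r X j : tally i r X j <= X.
Proof.
by elim: X => [|X IH]; [rewrite /tally big_ord0 | rewrite tallyS; lia].
Qed.

Lemma peakS i r X :
  peak i r X.+1 = maxn (peak i r X) (tally i r X.+1 (shift i r X)).
Proof. by rewrite /peak big_ord_recr. Qed.

Lemma peak_le i r X : peak i r X <= X.
Proof.
by apply/bigmax_leqP=> x _; apply: leq_trans (tally_le _ _ _ _) _.
Qed.

Lemma best_le i r : best i r <= n.
Proof.
rewrite geq_max; apply/andP; split; apply/bigmax_leqP=> x _.
  by apply/bigmax_leqP=> y _; apply: peak_le.
exact: peak_le.
Qed.

Definition clear_inv i r b X s : Prop :=
  [/\ ready s, [/\ reg s rP = 3 + n + i * n, reg s rQ = reps_addr + r * n,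
      reg s rX = X & reg s rBest = b] &
      forall j, j < X -> mem s (tally_addr + j) = 0].

Definition count_inv i r b X s : Prop :=
  [/\ ready s, [/\ reg s rP = 3 + n + i * n, reg s rQ = reps_addr + r * n,
      reg s rX = X & reg s rBest = maxn b (peak i r X)] &
      forall j, j < n -> mem s (tally_addr + j) = tally i r X j].

Lemma clear_stepP i r b X s :
  X < n -> clear_inv i r b X s ->
  runs w (block clear_step) 4 s (clear_inv i r b X.+1).
Proof.
move=> Xn [rs [rP rQ rX rb] ms]; have [regs mems] := rs.
have nt : n <= tally_addr by rewrite /tally_addr /reps_addr; lia.
have [r4 r5 r8] : [/\ reg s 4 = 1, reg s 5 = 0 & reg s 8 = tally_addr].
  by rewrite !regs.
apply: runs_add; first by rewrite r8 rX; lia.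
apply: runs_write; apply: runs_add; first by rewrite /= rX r4; lia.
apply: runs_nil; split.
- apply: ready_set_reg => //; apply: ready_set_mem; last exact: ready_set_reg.
  by rewrite /= r8; lia.
- by split=> //=; rewrite rX r4 addn1.
move=> j jX /=; rewrite r8 r5 rX; case: eqP => // jX'.
by apply: ms; lia.
Qed.

(** The cost 18 is 15 plain instructions, 2 for the conditional and 1 for the closing [Skip]. Only
    one tally grows at each point, so comparing that one keeps the maximum right. *)
Lemma count_stepP i r b X s :
  i < k -> r < m -> X < n -> b <= n -> count_inv i r b X s ->
  runs w (block count_step) 18 s (count_inv i r b X.+1).
Proof.
move=> ik rm Xn bn [rs [rP rQ rX rb] ms]; have [regs mems] := rs.
have ib := perm_block_le ik; have rb' := rep_block_le rm.
have nt : 3 + n <= tally_addr by rewrite /tally_addr /reps_addr; lia.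
have pt : 3 + n + i * n + n <= tally_addr.
  by rewrite /tally_addr /reps_addr; lia.
have qt : reps_addr + r * n + n <= tally_addr by rewrite /tally_addr; lia.
have [r1 r4 r5] : [/\ reg s 1 = n, reg s 4 = 1 & reg s 5 = 0] by rewrite !regs.
have [r6 r8] : [/\ reg s 6 = 3 & reg s 8 = tally_addr] by rewrite !regs.
have pn := perm_lt ik Xn; have un := pi_lt Xn.
have vn := rep_lt rm pn; have jn := shift_lt ik rm Xn.
have tl := tally_le i r X (shift i r X).
have pl := peak_le i r X.
have memp : mem s (3 + n + i * n + X) = perm_entry i X.
  by apply: mems; rewrite /tally_addr /reps_addr; lia.
have memv : mem s (reps_addr + r * n + perm_entry i X)
            = rep_entry r (perm_entry i X).
  by apply: mems; rewrite /tally_addr; lia.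
have memu : mem s (3 + X) = A (3 + X) by apply: mems; lia.
apply: runs_add; first by rewrite rP rX; lia.
apply: runs_read; rewrite /= rP rX memp.
apply: runs_add; first by rewrite /= rQ; lia.
apply: runs_read; rewrite /= rQ memv.
apply: runs_add; first by rewrite /= r6 rX; lia.
apply: runs_read; rewrite /= r6 rX memu.
apply: runs_select; first by rewrite /= r1 r5; lia.
rewrite /= r1 r5 addn0.
apply: runs_add; first by rewrite /=; case: ifP; lia.
apply: runs_sub; rewrite /= -/(shift i r X).
apply: runs_add; first by rewrite /= r8; lia.
apply: runs_read; rewrite /= r8 ms //.
apply: runs_add; first by rewrite /= r4; lia.
apply: runs_write; apply: runs_sub; rewrite /= r4.
apply: runs_add; first by rewrite /= rb; lia.
rewrite /= rb; apply: runs_add; first by rewrite /= rX r4; lia.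
rewrite /= rX r4; apply: runs_nil; split.
- do 3! apply: ready_set_reg => //.
  apply: ready_set_mem; first by rewrite /=; lia.
  by do ![apply: ready_set_reg => //].
- by split=> //=; rewrite ?addn1 // peakS tallyS eqxx; lia.
move=> j jlt /=; rewrite eqn_add2l tallyS (eq_sym j).
by case: eqP => [-> //| _]; rewrite ms // addn0.
Qed.

Definition rep_inv i r s : Prop :=
  [/\ ready s, reg s rP = 3 + n + i * n, reg s rQ = reps_addr + r * n
    & reg s rBest = best i r].

(** Nested the way the block rules add up costs; 5 and 19 are the loop bodies plus one test each. *)
Definition rep_time := 1 + ((n * 5).+1 + (1 + ((n * 19).+1 + 2))).

Lemma rep_stepP i r s :
  i < k -> r < m -> rep_inv i r s ->
  runs w (block rep_step) rep_time s (rep_inv i r.+1).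
Proof.
move=> ik rm [rs rP rQ rb].
have w0 : 0 < 2 ^ w by rewrite expn_gt0.
have qt : reps_addr + r * n + n <= tally_addr.
  by have := rep_block_le rm; rewrite /tally_addr; lia.
apply: runs_const => //; apply: runs_cons.
have init : clear_inv i r (best i r) 0 (set_reg s 11 0).
  by split=> //; apply: ready_set_reg.
(* Only the postcondition is weakened here: the final invariant of the loop becomes the precondition
   of the rest of the block. *)
apply: runs_mono (runs_while _ _ init) (leqnn _) _ => //.
- by move=> X s1 _ [[regs _] [_ _ -> _] _]; rewrite regs.
- by move=> X s1 Xn; apply: clear_stepP.
move=> s1 [rs1 [rP1 rQ1 rX1 rb1] ms1].
apply: runs_const => //; apply: runs_cons.
have {}init : count_inv i r (best i r) 0 (set_reg s1 11 0).
  split=> //; first exact: ready_set_reg.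
    by split=> //=; rewrite /peak big_ord0 maxn0.
  by move=> j jn /=; rewrite ms1 // /tally big_ord0.
apply: runs_mono (runs_while _ _ init) (leqnn _) _ => //.
- by move=> X s2 _ [[regs _] [_ _ -> _] _]; rewrite regs.
- by move=> X s2 Xn; apply: count_stepP => //; apply: best_le.
move=> s2 [rs2 [rP2 rQ2 rX2 rb2] ms2]; have [regs2 _] := rs2.
apply: runs_add; first by rewrite rQ2 regs2 //=; lia.
apply: runs_nil; split=> //=; first exact: ready_set_reg.
  by rewrite rQ2 regs2 //=; lia.
by rewrite rb2 /best big_ord_recr /= maxnA.
Qed.

Definition perm_inv i s : Prop :=
  [/\ ready s, reg s rP = 3 + n + i * n & reg s rBest = best i 0].

Definition perm_time := 1 + ((m * rep_time.+1).+1 + 2).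

Lemma perm_stepP i s :
  i < k -> perm_inv i s ->
  runs w (block perm_step) perm_time s (perm_inv i.+1).
Proof.
move=> ik [rs rP rb]; have [regs _] := rs.
have pt : 3 + n + i * n + n <= reps_addr.
  by have := perm_block_le ik; rewrite /reps_addr; lia.
have rt : reps_addr <= tally_addr by rewrite leq_addr.
apply: runs_add; first by rewrite !regs //=; lia.
rewrite !regs //= addn0; apply: runs_cons.
have init : rep_inv i 0 (set_reg s 10 reps_addr).
  by split=> //=; [apply: ready_set_reg | rewrite mul0n addn0].
apply: runs_mono (runs_while _ _ init) (leqnn _) _ => //.
(* Comparing addresses counts iterations because each array occupies [n > 0] cells. *)
- move=> r s1 _ [[regs1 _] _ -> _].
  by rewrite regs1 //= ltn_add2l ltn_pmul2r.
- by move=> r s1 rm; apply: rep_stepP.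
move=> s1 [rs1 rP1 rQ1 rb1]; have [regs1 _] := rs1.
apply: runs_add.
  by rewrite rP1 regs1 //=; lia.
apply: runs_nil; split=> //=; first exact: ready_set_reg.
  by rewrite rP1 regs1 //=; lia.
(* [best i m] equals [best i.+1 0]: the completed inner maximum becomes the last term of the outer
   one. *)
by rewrite rb1 /best big_ord_recr big_ord0 /= maxn0.
Qed.

(** * Computation of the addresses, and the whole run *)

Definition setup reps tallies x s : Prop :=
  (forall y, y < 16 ->
     reg s y =
     nth 0 [:: 0; n; k; m; 1; 0; 3; reps; tallies; 3 + n; 0; x; 2] y) /\
  mem s = A.

Lemma setup_reps b b' c x s : setup b c x s -> setup b' c x (set_reg s 7 b').
Proof.
by move=> [regs ms]; split=> // -[|[|[|[|[|[|[|[]]]]]]]] //= *; rewrite ?regs.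
Qed.

Lemma setup_tallies b c c' x s : setup b c x s -> setup b c' x (set_reg s 8 c').
Proof.
move=> [regs ms]; split=> // -[|[|[|[|[|[|[|[|[]]]]]]]]] //= *;
  by rewrite ?regs.
Qed.

Lemma setup_counter b c x x' s :
  setup b c x s -> setup b c x' (set_reg s 11 x').
Proof.
move=> [regs ms]; split=> // -[|[|[|[|[|[|[|[|[|[|[|[]]]]]]]]]]]] //= *;
  by rewrite ?regs.
Qed.

(** The 8 counts the instructions before the first loop; the last 2 are the final subtraction and
    [Skip]. *)
Definition total_time :=
  8 + ((k * 4).+1 + (2 + ((m * 4).+1 + ((k * perm_time.+1).+1 + 2)))).

Lemma hd_programP :
  runs w hd_program total_time (State (fun=> 0) A)
    (fun s => reg s 0 = n - best k 0).
Proof.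
have kt : 3 + n + k <= tally_addr.
  by have := leq_pmulr k n_gt0; rewrite /tally_addr /reps_addr; lia.
have mt : m <= tally_addr.
  by have := leq_pmulr m n_gt0; rewrite /tally_addr; lia.
have rt : reps_addr <= tally_addr by rewrite leq_addr.
do 3! (apply: runs_const; first lia); do 3! apply: runs_read.
rewrite /= A0 A1 A2; apply: runs_add; first by rewrite /=; lia.
apply: runs_add; first by rewrite /=; lia.
rewrite /= addn0; apply: (@runs_cons _ _ _ (k * 4).+1).
set s := set_reg _ 9 _.
pose I1 i := setup (3 + n + i * n) 0 i.
have init : I1 0 s.
  by rewrite /I1 mul0n addn0; split=> //; do 16! case=> //.
apply: runs_mono (runs_while (I := I1) _ _ init) (leqnn _) _ => //.
- by move=> i s1 _ [regs _]; rewrite !regs //= ?addn0.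
- move=> i s1 ik [regs ms]; have ib := perm_block_le ik.
  have pt : 3 + n + i * n + n <= reps_addr by rewrite /reps_addr; lia.
  apply: runs_add; first by rewrite !regs //= ?addn0; lia.
  apply: runs_add; first by rewrite /= !regs //= ?addn0; lia.
  apply: runs_nil; rewrite /= !regs //= ?addn0.
  rewrite addn1 /I1 mulSnr addnA; apply: (@setup_counter _ _ i).
  exact: setup_reps (conj regs ms).
move=> {init}s.
rewrite /I1 -/reps_addr => -[regs ms].
apply: runs_const; first lia.
apply: runs_add; first by rewrite /= !regs //= ?addn0; lia.
rewrite /= !regs //= ?addn0; apply: (@runs_cons _ _ _ (m * 4).+1).
set s1 := set_reg _ 8 _.
pose I2 r := setup reps_addr (reps_addr + r * n) r.
have init : I2 0 s1.
  rewrite /I2 mul0n addn0; apply: (@setup_tallies _ 0).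
  exact: setup_counter (conj regs ms).
apply: runs_mono (runs_while (I := I2) _ _ init) (leqnn _) _ => //.
- by move=> r s2 _ [regs2 _]; rewrite !regs2 //= ?addn0.
- move=> r s2 rm [regs2 ms2]; have rb := rep_block_le rm.
  have qt : reps_addr + r * n + n <= tally_addr by rewrite /tally_addr; lia.
  apply: runs_add; first by rewrite !regs2 //= ?addn0; lia.
  apply: runs_add; first by rewrite /= !regs2 //= ?addn0; lia.
  apply: runs_nil; rewrite /= !regs2 //= ?addn0.
  rewrite addn1 /I2 mulSnr addnA; apply: (@setup_counter _ _ r).
  exact: setup_tallies (conj regs2 ms2).
move=> {regs ms init} s2.
rewrite /I2 -/tally_addr => -[regs ms]; apply: runs_cons.
have init : perm_inv 0 s2.
  split.
  - split; last by rewrite ms.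
    by move=> y y9; rewrite regs; [move: y y9; do 9! case=> // | lia].
  - by rewrite regs //= mul0n addn0.
  - by rewrite regs //= /best !big_ord0.
apply: runs_mono (runs_while _ _ init) (leqnn _) _ => //.
- move=> i s3 _ [[regs3 _] -> _].
  by rewrite regs3 //= /reps_addr ltn_add2l ltn_pmul2r.
- by move=> i s3 ik; apply: perm_stepP.
move=> s3 [[regs3 _] _ rb]; apply: runs_sub; apply: runs_nil.
by rewrite /= rb regs3.
Qed.

(** Tallies only grow, so every recorded value is at most the final tally of its bin. Conversely, a
    bin has its final value when it is last hit, and that value is recorded. *)
Lemma peak_full i r :
  (forall x, x < n -> shift i r x < n) ->
  peak i r n = \max_(j < n) tally i r n j.
Proof.
move=> sn; apply/eqP; rewrite eqn_leq; apply/andP; split.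
  apply/bigmax_leqP=> x _.
  rewrite (bigmax_sup (Ordinal (sn _ (ltn_ord x)))) //=.
  suff H X : x < X -> tally i r x.+1 (shift i r x) <= tally i r X (shift i r x).
    exact: H.
  elim: X => // X IH; rewrite ltnS leq_eqVlt => /predU1P[->//|xX].
  by rewrite (leq_trans (IH xX)) // [leqRHS]tallyS leq_addr.
apply/bigmax_leqP=> j _.
suff H X : tally i r X j <= peak i r X by apply: H.
elim: X => [|X IH].
  by rewrite /tally big_ord0.
rewrite peakS tallyS leq_max; case: eqP => [<-|_]; last by rewrite addn0 IH.
by rewrite orbC tallyS eqxx leqnn.
Qed.

End Correctness.

(** The time expands to [24kmn + 7km + 9k + 4m + 15]. Each monomial is at most [kmn], so 59 would do
    and 100 is a round bound. *)
Lemma total_time_le n k m :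
  0 < n -> 0 < k -> 0 < m -> total_time n k m <= 100 * (k * (m * n)).
Proof.
move=> n0 k0 m0.
have kN : k <= k * (m * n) by rewrite leq_pmulr // muln_gt0 m0.
have mN : m <= k * (m * n).
  by apply: leq_trans (leq_pmull _ k0); apply: leq_pmulr.
have kmN : k * m <= k * (m * n) by rewrite leq_mul2l leq_pmulr ?orbT.
rewrite /total_time /perm_time /rep_time; nia.
Qed.

(** * Reading the permutations back from the encoded input *)

Section Encoding.

Variables (n k : nat) (pis : k.-tuple 'S_n) (reps : seq 'S_n) (pi : 'S_n).

Local Notation input := (encode_input pis reps pi).
Local Notation m := (size reps).
Local Notation A := (nth 0 input).

Lemma size_array (s : 'S_n) : size (array s) = n.
Proof. by rewrite size_map size_enum_ord. Qed.

Lemma nth_array (s : 'S_n) (x : 'I_n) : nth 0 (array s) x = s x.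
Proof. by rewrite (nth_map x) ?size_enum_ord // nth_ord_enum. Qed.

Lemma size_arrays (l : seq 'S_n) :
  size (flatten [seq array s | s <- l]) = size l * n.
Proof. by elim: l => //= s l IH; rewrite size_cat IH size_array. Qed.

Lemma nth_arrays (l : seq 'S_n) i (x : 'I_n) :
  i < size l ->
  nth 0 (flatten [seq array s | s <- l]) (i * n + x) = nth 1%g l i x.
Proof.
elim: l i => // s l IH [|i] /= il; rewrite nth_cat size_array.
  by rewrite mul0n ltn_ord nth_array.
by rewrite mulSn -addnA ltnNge leq_addr /= addKn IH.
Qed.

Lemma size_input : size input = tally_addr n k m.
Proof.
rewrite /encode_input /= !size_cat size_array !size_arrays size_tuple.
by rewrite /tally_addr /reps_addr !addnA.
Qed.

Lemma input_pi (x : 'I_n) : A (3 + x) = pi x.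
Proof. by rewrite /= nth_cat size_array ltn_ord nth_array. Qed.

Lemma input_perm (i : 'I_k) (x : 'I_n) : perm_entry n A i x = tnth pis i x.
Proof.
have ib := perm_block_le n (ltn_ord i); have xn := ltn_ord x.
rewrite /perm_entry -!addnA /= add0n.
rewrite nth_cat size_array ifF; last lia.
rewrite addKn nth_cat size_arrays size_tuple ifT; last lia.
by rewrite nth_arrays ?size_tuple // (tnth_nth 1%g).
Qed.

Lemma input_rep (r : 'I_m) (x : 'I_n) : rep_entry n k A r x = nth 1%g reps r x.
Proof.
rewrite /rep_entry /reps_addr -!addnA /= add0n.
rewrite nth_cat size_array ifF; last lia.
rewrite addKn nth_cat size_arrays size_tuple ifF; last lia.
by rewrite addKn nth_arrays.
Qed.

(** * Agreements, Hamming distance and tallies *)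

Definition agree (s t : 'S_n) := #|[set x | s x == t x]|.

Lemma hd_agree s t : hd s t = n - agree s t.
Proof.
have := cardsC [set x | s x == t x]; rewrite card_ord /hd /agree.
have ->: ~: [set x | s x == t x] = [set x | s x != t x].
  by apply/setP=> x; rewrite !inE.
lia.
Qed.

(** [subn n] turns maxima into minima and sends 0, the empty maximum, to the default [n] of
    [hd_set]. *)
Lemma hd_set_agree s (P : {set 'S_n}) :
  hd_set s P = n - \max_(t in P) agree s t.
Proof.
rewrite (big_morph (subn n) (id1 := n) (op1 := minn)).
- by apply: eq_bigr => t _; apply: hd_agree.
- by move=> a b; lia.
- exact: subn0.
Qed.

(** For [u, v, j < n], the equation [u = v + j] modulo [n] has one solution [j]. The proof splits on
    whether [v + j] wraps around, which it does at most once. *)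
Lemma shiftP (i : 'I_k) (r : 'I_m) (x j : 'I_n) :
  (shift n k A i r x == j) =
  (pi x == (tnth pis i * nth 1%g reps r * rotation j)%g x).
Proof.
rewrite /shift input_pi input_perm input_rep !permM permE -val_eqE /=.
move: (ltn_ord (pi x)) (ltn_ord (nth 1%g reps r (tnth pis i x))) (ltn_ord j).
set u := val _; set v := val _ => un vn jn.
have [vj|vj] := ltnP (v + j) n; first by rewrite modn_small //; case: ifP; lia.
rewrite -[v + j](subnK vj) modnDr modn_small; last lia.
by case: ifP; lia.
Qed.

Lemma tally_agree (i : 'I_k) (r : 'I_m) (j : 'I_n) :
  tally n k A i r n j = agree pi (tnth pis i * nth 1%g reps r * rotation j)%g.
Proof.
rewrite /agree -sum1_card big_mkcond /=; apply: eq_bigr => x _.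
by rewrite inE -shiftP; case: eqP.
Qed.

Lemma best_agree :
  best n k m A k 0 = \max_(i < k) \max_(r < m) \max_(j < n)
    agree pi (tnth pis i * nth 1%g reps r * rotation j)%g.
Proof.
rewrite /best big_ord0 maxn0; apply: eq_bigr => i _; apply: eq_bigr => r _.
rewrite peak_full => [|x xn].
  by apply: eq_bigr => j _; apply: tally_agree.
pose x' := Ordinal xn; have pE := input_perm i x'; have piE := input_pi x'.
rewrite /shift pE (input_rep r) piE /=.
have := ltn_ord (pi x'); have := ltn_ord (nth 1%g reps r (tnth pis i x')).
by case: ifP; lia.
Qed.


(** * Cosets of the rotations and their representatives *)

Variable G : {group 'S_n}.
Hypothesis repsP : lcoset_reps (rotations n) G reps.

Lemma card_rotations : #|rotations n| = n.
Proof.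
rewrite card_imset ?card_ord // => j1 j2 /permP eq_j.
(* The index [j1] doubles as the point of evaluation. *)
have := congr1 val (eq_j j1); rewrite !permE /= => /eqP.
by rewrite eqn_modDl !modn_small // => /eqP/val_inj.
Qed.

(** The left cosets partition [G] into blocks of size [n], and a transversal has one element in
    each. *)
Lemma card_reps : #|G| = m * n.
Proof.
have /andP[reps_uniq repsT] := repsP; have /and3P[partG _ _] := repsT.
have <-: #|[set r in reps]| = m by rewrite cardsE; apply/card_uniqP.
rewrite (card_transversal repsT).
apply: card_uniform_partition partG => _ /imsetP[r _ ->].
by rewrite lcosetE card_lcoset card_rotations.
Qed.

Lemma reps_sub r : r \in reps -> r \in G.
Proof.
have /andP[_ /and3P[_ /subsetP sub _]] := repsP.
by move=> rr; apply: sub; rewrite inE.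
Qed.

(** Supplies quotients of rotations, as [rotations] is a mere set here. The index is [j1 - j2]
    modulo [n], written [j1 + (n - j2)] to avoid truncation. *)
Lemma rotation_div (j1 j2 : 'I_n) :
  exists j, rotation j1 = (rotation j2 * rotation j)%g.
Proof.
have lt_n : (j1 + (n - j2)) %% n < n.
  by rewrite ltn_mod (leq_ltn_trans _ (ltn_ord j1)).
exists (Ordinal lt_n); apply/permP=> x; rewrite permM !permE.
apply: val_inj; rewrite /= modnDm -[in LHS]modnDr; congr (_ %% _).
have := ltn_ord j2; lia.
Qed.

(** The coset of [g] contains some representative [r]. Both are the same element [a] times a
    rotation, so they differ by a rotation. *)
Lemma reps_cover g :
  g \in G -> exists r : 'I_m, exists j, g = (nth 1%g reps r * rotation j)%g.
Proof.
have /andP[_ /and3P[partG _ /forall_inP one]] := repsP.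
rewrite -{1}(cover_partition partG) => /bigcupP[B BG gB].
have /cards1P[r /setP rB] := one B BG; have := rB r; rewrite !inE eqxx.
case/andP=> rr; case/imsetP: BG gB {rB} => a _ ->; rewrite lcosetE.
case/lcosetP=> _ /imsetP[j1 _ ->] -> /lcosetP[_ /imsetP[j2 _ ->] ra].
have [j ->] := rotation_div j1 j2.
have rm : index r reps < m by rewrite index_mem.
by exists (Ordinal rm), j; rewrite nth_index // ra mulgA.
Qed.

(** The union consists of exactly the products of some [tnth pis i], a representative and a
    rotation: [reps_cover] gives one inclusion, closure of [G] under products the other. *)
Lemma best_hd_set : rotations n \subset G ->
  hd_set pi (\bigcup_(i < k) (tnth pis i *: G)%g) = n - best n k m A k 0.
Proof.
move=> rotG; rewrite hd_set_agree best_agree; congr (n - _).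
apply/eqP; rewrite eqn_leq; apply/andP; split; apply/bigmax_leqP.
  move=> t /bigcupP[i _ /lcosetP[g /reps_cover[r [j ->]] ->]].
  by rewrite (bigmax_sup i) // (bigmax_sup r) // (bigmax_sup j) // mulgA.
move=> i _; apply/bigmax_leqP=> r _; apply/bigmax_leqP=> j _.
apply: leq_bigmax_cond; apply/bigcupP; exists i => //.
rewrite -mulgA mem_lcoset mulKg groupM //; first by rewrite reps_sub ?mem_nth.
by apply: (subsetP rotG); apply: imset_f.
Qed.

End Encoding.

Theorem theorem5 :
  exists (p : program) (c d : nat),
  forall (n k : nat) (G : {group 'S_n}) (pis : k.-tuple 'S_n)
         (reps : seq 'S_n) (pi : 'S_n) (w : nat),
    0 < n -> 0 < k ->
    rotations n \subset G ->
    lcoset_reps (rotations n) G reps ->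
    d * size (encode_input pis reps pi) <= 2 ^ w ->
    computes_within w p (encode_input pis reps pi)
      (hd_set pi (\bigcup_(i < k) (tnth pis i *: G)%g))
      (c * (k * #|G|)).
Proof.
(* 100 is the factor in [total_time_le], and 2 the headroom against wraparound. *)
exists hd_program, 100, 2 => n k G pis reps pi w n0 k0 rotG repsP wP.
(* A group is nonempty, so there is at least one coset. *)
have m0 : 0 < size reps.
  by have := cardG_gt0 G; rewrite (card_reps repsP) muln_gt0 => /andP[].
rewrite size_input in wP.
have := @hd_programP w n k (size reps) (nth 0 (encode_input pis reps pi)) n0 wP.
case=> //.
- by rewrite /= size_tuple.
- by move=> x xn; rewrite (input_pi _ _ _ (Ordinal xn)).
- by move=> i x ik xn; rewrite (input_perm _ _ _ (Ordinal ik) (Ordinal xn)).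
- by move=> r x rm xn; rewrite (input_rep _ _ (Ordinal rm) (Ordinal xn)).
move=> t [s [ps tT out]]; exists t, s; split=> //.
  by rewrite out (best_hd_set _ _ repsP rotG).
by rewrite (leq_trans tT) // (card_reps repsP) total_time_le.
Qed.
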